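(* Let $n\ge 2$ and let $G=C_n$ be the cycle graph. Let $K$ be a field, $T=K[s_i,t_i: 1\le i\le n]$, and let $I\subset T$ be the monomial ideal of independent sets of $C_n$. Then $$\beta_i(I)=\sum_{k=0}^{\left\lfloor \frac{n}{2}\right\rfloor}\frac{n}{n-k}\binom{n-k}{k}\binom{k}{i}\quad\text{for } i\ge 0,\qquad\text{and}\qquad \mathrm{proj\,dim}(T/I)=\left\lfloor \frac{n}{2}\right\rfloor+1.$$
   Context: $C_n$ is the cycle graph on $\{1,\dots,n\}$, with edges $\{i,i+1\}$ for $1\le i\le n-1$ and $\{n,1\}$; for $n=2$, $C_2$ is understood as the simple graph with the single edge $\{1,2\}$. A set of vertices of a graph is independent if no two of its elements are adjacent (the empty set is independent). The monomial ideal of independent sets of a graph $G$ with vertex set $V(G)$ is the squarefree monomial ideal of $K[s_i,t_i:i\in V(G)]$ generated by the monomials $\prod_{r\in S}s_r\prod_{r\in V(G)\setminus S}t_r$, with $S$ ranging over all independent sets of $G$. $\beta_i(I)$ denotes the $i$-th total Betti number, i.e. the rank of the $i$-th free module in the minimal graded free resolution of $I$ over $T$ (with $\beta_0(I)$ the number of minimal generators of $I$). *)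

(* Defs.v *)
From HB Require Import structures.
From mathcomp Require Import all_boot all_order all_algebra.
From mathcomp Require Import boolp.
From mathcomp Require Import mpoly.

Set Implicit Arguments.
Unset Strict Implicit.
Unset Printing Implicit Defensive.

Import GRing.Theory.
Local Open Scope ring_scope.

(** * Submodules and quotient modules *)

Section Span.
Variables (R : comNzRingType) (V : lmodType R).

Definition in_span (G : V -> Prop) (v : V) : Prop :=
  exists s : seq (R * V),
    (forall x, x \in s -> G x.2) /\ v = \sum_(x <- s) x.1 *: x.2.

Definition span (G : V -> Prop) : {pred V} := fun v => `[< in_span G v >].

Lemma span_submod_closed G : GRing.submod_closed (span G).
Proof.
split=> [|a u v /asboolP[su [Gu ->]] /asboolP[sv [Gv ->]]]; apply/asboolP.
  by exists [::]; split=> //; rewrite big_nil.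
exists ([seq (a * x.1, x.2) | x <- su] ++ sv); split.
  by move=> x; rewrite mem_cat => /orP[/mapP[y /Gu Gy ->]|/Gv].
rewrite big_cat big_map scaler_sumr; congr (_ + _).
by apply: eq_bigr => x _; rewrite scalerA.
Qed.

HB.instance Definition _ G :=
  GRing.isSubmodClosed.Build R V (span G) (span_submod_closed G).

End Span.

Section QuotientModule.
Variables (R : comNzRingType) (V : lmodType R) (N : submodClosed V).

(* [submodClosed] does not provide closure under opposite, which the quotient
   construction needs. *)
Definition submod_pred : {pred V} := fun v => v \in N.

Lemma submod_pred_zmod_closed : zmod_closed submod_pred.
Proof.
have [N0 NL] := submodClosedP N; split=> // u v Nu Nv.
by rewrite unfold_in -[- v]scaleN1r addrC; apply: NL.
Qed.

HB.instance Definition _ :=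
  GRing.isZmodClosed.Build V submod_pred submod_pred_zmod_closed.

Definition quot_mod : Type := (@Quotient.quot V submod_pred).
HB.instance Definition _ := GRing.Zmodule.on quot_mod.

Definition quot_proj (v : V) : quot_mod := (\pi_(Quotient.quot submod_pred) v)%qT.
Definition quot_scale (a : R) (x : quot_mod) : quot_mod :=
  quot_proj (a *: (repr (x : (Quotient.quot submod_pred)))%qT).

Lemma quot_projK (x : quot_mod) : quot_proj (repr (x : (Quotient.quot submod_pred)))%qT = x.
Proof. exact: reprK. Qed.

Lemma quot_proj_eq u v : (quot_proj u = quot_proj v) <-> (u - v \in N).
Proof.
rewrite -[u - v \in N]/(u - v \in submod_pred) Quotient.idealrBE.
by split=> /eqP.
Qed.

Lemma quot_projD u v : quot_proj (u + v) = quot_proj u + quot_proj v.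
Proof. exact: raddfD. Qed.

Lemma quot_projZ a v : quot_proj (a *: v) = quot_scale a (quot_proj v).
Proof.
apply/quot_proj_eq; rewrite -scalerBr rpredZ //.
by apply/quot_proj_eq; rewrite quot_projK.
Qed.

Lemma quot_scaleA a b x :
  quot_scale a (quot_scale b x) = quot_scale (a * b) x.
Proof. by rewrite -[x]quot_projK -!quot_projZ scalerA. Qed.

Lemma quot_scale1 : left_id 1 quot_scale.
Proof. by move=> x; rewrite -[x]quot_projK -quot_projZ scale1r. Qed.

Lemma quot_scaleDr : right_distributive quot_scale +%R.
Proof.
move=> a x y; rewrite -[x]quot_projK -[y]quot_projK.
by rewrite -quot_projD -!quot_projZ -quot_projD scalerDr.
Qed.

Lemma quot_scaleDl x : {morph quot_scale^~ x : a b / a + b}.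
Proof.
by move=> a b; rewrite -[x]quot_projK -!quot_projZ -quot_projD scalerDl.
Qed.

HB.instance Definition _ := GRing.Zmodule_isLmodule.Build R quot_mod
  quot_scaleA quot_scale1 quot_scaleDr quot_scaleDl.

Lemma quot_proj_is_linear : linear quot_proj.
Proof. by move=> a u v; rewrite quot_projD quot_projZ. Qed.

HB.instance Definition _ :=
  GRing.isLinear.Build R V quot_mod *:%R quot_proj quot_proj_is_linear.

End QuotientModule.

(** * Projective dimension *)

Section ProjectiveDimension.
Variable R : comNzRingType.

Definition projective (P : lmodType R) : Prop :=
  forall (M N : lmodType R) (f : {linear M -> N}) (g : {linear P -> N}),
    (forall y, exists x, f x = y) ->
    exists h : {linear P -> M}, forall p, f (h p) = g p.

Record proj_resolution (M : lmodType R) := ProjResolution {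
  pr_mod : nat -> lmodType R;
  pr_diff : forall i, {linear pr_mod i.+1 -> pr_mod i};
  pr_aug : {linear pr_mod 0 -> M};
  pr_projective : forall i, projective (pr_mod i);
  pr_aug_surj : forall y, exists x, pr_aug x = y;
  pr_exact0 : forall x, pr_aug x = 0 <-> exists y, x = pr_diff 0 y;
  pr_exact : forall i x, pr_diff i x = 0 <-> exists y, x = pr_diff i.+1 y
}.

Definition proj_dim_le (M : lmodType R) (d : nat) : Prop :=
  exists P : proj_resolution M,
    forall i, (d < i)%N -> forall x : pr_mod P i, x = 0.

Definition has_proj_dim (M : lmodType R) (d : nat) : Prop :=
  proj_dim_le M d /\ forall e, proj_dim_le M e -> (d <= e)%N.

End ProjectiveDimension.

(** * Minimal graded free resolutions and Betti numbers *)

Section Betti.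
Variables (K : fieldType) (m : nat).
Local Notation T := {mpoly K[m]}.

(* The [i]-th term is the free module of row vectors with [fr_rank i] entries,
   with basis vector [e_p] in degree [fr_deg i p]; maps act by right
   multiplication, so row [p] of [fr_diff i] is the image of [e_p]. *)
Record free_complex := FreeComplex {
  fr_rank : nat -> nat;
  fr_deg : forall i, 'I_(fr_rank i) -> int;
  fr_diff : forall i, 'M[T]_(fr_rank i.+1, fr_rank i);
  fr_aug : 'cV[T]_(fr_rank 0)
}.

(* All maps are homogeneous of degree 0 (for the standard grading of [T]). *)
Definition fr_graded (F : free_complex) : Prop :=
  (forall p mu, mu \in msupp (fr_aug F p 0) -> (mdeg mu)%:Z = fr_deg p) /\
  (forall i p q mu, mu \in msupp (fr_diff F i p q) ->
     (mdeg mu)%:Z + fr_deg q = fr_deg p).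

Definition fr_resolves (I : {pred T}) (F : free_complex) : Prop :=
  [/\ forall f : T, f \in I <->
        exists v : 'rV_(fr_rank F 0), f = (v *m fr_aug F) 0 0,
      forall v : 'rV_(fr_rank F 0),
        v *m fr_aug F = 0 <-> exists w, v = w *m fr_diff F 0
    & forall i (v : 'rV_(fr_rank F i.+1)),
        v *m fr_diff F i = 0 <-> exists w, v = w *m fr_diff F i.+1].

(* The image of each differential lies in (x_1, ..., x_m) times its target. *)
Definition fr_minimal (F : free_complex) : Prop :=
  forall i p q, (fr_diff F i p q)@_0%MM = 0.

Definition minimal_graded_free_resolution (I : {pred T}) (F : free_complex) :
    Prop :=
  [/\ fr_graded F, fr_resolves I F & fr_minimal F].

(* The choice of the resolution is unspecified, so any statement about [betti]
   is a statement about every possible choice; the value 0 is only used when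
   there is no minimal graded free resolution. *)
Definition betti (I : {pred T}) (i : nat) : nat :=
  if pselect (exists F, minimal_graded_free_resolution I F) is left exF
  then fr_rank (projT1 (cid exF)) i else 0.

End Betti.

(** * Ideals of independent sets *)

Section IndependentSets.
Variables (K : fieldType) (n : nat).
Local Notation T := {mpoly K[n + n]}.

(* The variables s_i come first, followed by the t_i. *)
Definition svar (i : 'I_n) : T := 'X_(lshift n i).
Definition tvar (i : 'I_n) : T := 'X_(rshift n i).

Definition independent (adj : rel 'I_n) (S : {set 'I_n}) : bool :=
  [forall i in S, forall j in S, ~~ adj i j].

Definition indep_monomial (S : {set 'I_n}) : T :=
  (\prod_(r in S) svar r) * \prod_(r in ~: S) tvar r.

(* [T^o] is [T] as a module over itself: ideals are its submodules. *)
Definition indep_ideal (adj : rel 'I_n) : {pred T^o} :=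
  span (fun f : T^o => exists2 S, independent adj S & f = indep_monomial S).

HB.instance Definition _ adj := GRing.SubmodClosed.on (indep_ideal adj).

End IndependentSets.
Arguments indep_ideal K {n} adj.

(* Vertices are 0, ..., n - 1; loopless for n >= 2, and for n = 2 both disjuncts
   give the same single edge. *)
Definition cycle_adj n : rel 'I_n :=
  fun i j => (val j == i.+1 %% n)%N || (val i == j.+1 %% n)%N.
Arguments cycle_adj : clear implicits.

(* Main.v *)
Require Import Defs.
From HB Require Import structures.
From mathcomp Require Import all_boot all_order all_algebra.
From mathcomp Require Import boolp mpoly.
From mathcomp Require Import ring zify.
Import GRing.Theory.
Local Open Scope ring_scope.

Set Implicit Arguments.
Unset Strict Implicit.
Unset Printing Implicit Defensive.

(** For every graph, the ideal of independent sets has an explicit minimal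
    resolution, read off from a cubical complex.  Write m_S for the generator
    attached to the independent set S, the product of the s_r for r in S and of
    the t_r for r outside S.  The complex has one basis vector for each pair
    (S, A) with A a subset of the independent set S, in homological degree #|A|
    and in multidegree m_S times the product of the t_a for a in A: the pair is
    the cube of all independent sets between S minus A and S.  Its two facets in
    direction a are (S, A - a) and (S - a, A - a), and they enter the boundary
    with the coefficients t_a and - s_a.  All the subsets of S are independent,
    so every facet belongs to the complex.

    Exactness rests on one contraction per vertex.  The vertices interact only
    through signs and multiplication by variables other than t_x, so dividing
    coefficients by t_x, that is keeping the monomials divisible by t_x and
    dividing these by t_x, gives a K-linear homotopy h_x with
    1 - (d h_x + h_x d) supported on pairs with x outside A
    ([homotopy_identity]).  Subtracting these boundaries from a cycle, one
    vertex after the other ([reduce_cycle]), leaves a chain in degree 0 whose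
    coefficient at S involves no t_x with x in S.  In positive degree this is
    zero; in degree 0 the products of such coefficients with the m_S have no
    monomial in common, so the augmentation is injective on them
    ([augmentation_reduced_eq0]).  All entries of the differentials are linear
    forms, so the resolution is minimal and its ranks are the sums over the
    independent sets S of the binomials C(#|S|, i).

    Ranks of a minimal resolution of a proper ideal are invariants, and they
    bound the projective dimension from below.  Both facts come from comparing
    the resolution F with an arbitrary projective resolution P of the quotient:
    the composite F -> P -> F is homotopic to the identity, and as the
    differentials of F have entries without constant term, the composite is the
    identity modulo the variables ([minimal_retract]).  If P is minimal and free
    the two ranks must agree; if P vanishes in some degree, so does F.  Hence
    the projective dimension of the quotient by I is the length of F plus one.

    It remains to count the independent sets of size k of the cycle.  They are
    the cyclic 0-1 words with no two consecutive ones, and the recursion on the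
    first letter gives C(n-k, k) + C(n-k-1, k-1), which is n/(n-k) C(n-k, k). *)

(** * Comparison of projective resolutions *)

Lemma dep_choice (S : nat -> Type) (r : forall i, S i -> S i.+1 -> Prop)
    (s0 : S 0) :
  (forall i (s : S i), exists s', r i s s') ->
  exists f : forall i, S i, f 0%N = s0 /\ forall i, r i (f i) (f i.+1).
Proof.
move=> step.
pose f := nat_rect S s0 (fun i s => projT1 (cid (step i s))).
by exists f; split=> // i; rewrite /f /=; case: (cid _).
Qed.

Section Lifting.
Variable R : comNzRingType.

(** Projectivity lifts along surjections only; the image of a linear map is
    therefore made into a module, onto which the map is surjective. *)
Section LinearImage.
Variables (M N : lmodType R) (d : {linear M -> N}).

Definition lin_image : {pred N} := fun y => `[< exists x, y = d x >].

Lemma lin_image_submod_closed : GRing.submod_closed lin_image.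
Proof.
split=> [|a u v /asboolP[x ->] /asboolP[y ->]]; apply/asboolP.
  by exists 0; rewrite linear0.
by exists (a *: x + y); rewrite linearP.
Qed.

HB.instance Definition _ :=
  GRing.isSubmodClosed.Build R N lin_image lin_image_submod_closed.

Record lin_range := LinRange { range_val : N; _ : range_val \in lin_image }.
HB.instance Definition _ := [isSub for range_val].
HB.instance Definition _ := [Choice of lin_range by <:].
HB.instance Definition _ := [SubChoice_isSubLmodule of lin_range by <:].

Lemma range_mem x : d x \in lin_image.
Proof. by apply/asboolP; exists x. Qed.

End LinearImage.

Lemma projective_lift (P A B : lmodType R) (d : {linear A -> B})
  (g : {linear P -> B}) :
  projective P -> (forall x, exists y, g x = d y) ->
  exists h : {linear P -> A}, forall x, d (h x) = g x.
Proof.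
move=> projP gd.
have g_im x : g x \in lin_image d.
  by have [y ->] := gd x; apply: range_mem.
pose d' x : lin_range d := LinRange (range_mem d x).
pose g' x : lin_range d := LinRange (g_im x).
have lin_d' : linear d' by move=> a x y; apply: val_inj; rewrite /= linearP.
have lin_g' : linear g' by move=> a x y; apply: val_inj; rewrite /= linearP.
pose D := GRing.isLinear.Build R A (lin_range d) *:%R d' lin_d'.
pose G := GRing.isLinear.Build R P (lin_range d) *:%R g' lin_g'.
pose dl : {linear A -> lin_range d} := HB.pack d' D.
pose gl : {linear P -> lin_range d} := HB.pack g' G.
have dl_surj y : exists x, dl x = y.
  by case: y => y y_im; case/asboolP: (y_im) => x yE; exists x; apply: val_inj.
have [h hP] := projP _ _ dl gl dl_surj.
by exists h => x; have /(congr1 val) := hP x.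
Qed.

Section Comparison.
Variables (M : lmodType R) (P Q : proj_resolution M).

Lemma diff_aug0 (F : proj_resolution M) x : pr_aug F (pr_diff F 0 x) = 0.
Proof. by apply/pr_exact0; exists x. Qed.

Lemma diff_diff0 (F : proj_resolution M) i x :
  pr_diff F i (pr_diff F i.+1 x) = 0.
Proof. by apply/pr_exact; exists x. Qed.

(** The invariant that lets a partial chain map be extended by one more degree:
    the term in degree i sends boundaries to cycles. *)
Definition bdry_to_cycle i : {linear pr_mod P i -> pr_mod Q i} -> Prop :=
  match i with
  | 0 => fun f => forall x, pr_aug Q (f (pr_diff P 0 x)) = 0
  | i.+1 => fun f => forall x, pr_diff Q i (f (pr_diff P i.+1 x)) = 0
  end.

Lemma bdry_to_cycle_exact i (f : {linear pr_mod P i -> pr_mod Q i}) x :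
  bdry_to_cycle f -> exists y, f (pr_diff P i x) = pr_diff Q i y.
Proof. by case: i f x => [|i] f x /(_ x); [move/pr_exact0 | move/pr_exact]. Qed.

(** Degree by degree, [projective_lift] applies because the previous term sends
    boundaries to cycles, which are boundaries in the exact complex Q; the new
    term then satisfies the same condition since d d = 0. *)
Lemma chain_map_lift :
  exists f : forall i, {linear pr_mod P i -> pr_mod Q i},
    (forall x, pr_aug Q (f 0 x) = pr_aug P x) /\
    forall i x, pr_diff Q i (f i.+1 x) = f i (pr_diff P i x).
Proof.
have [f0 f0P] := @projective_lift _ _ _ (pr_aug Q) (pr_aug P)
  (@pr_projective _ _ P 0)
  (fun x => let: ex_intro y e := pr_aug_surj Q (pr_aug P x) in
            ex_intro _ y (esym e)).
have f0c : bdry_to_cycle f0 by move=> x; rewrite f0P diff_aug0.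
pose S i := {f : {linear pr_mod P i -> pr_mod Q i} | bdry_to_cycle f}.
pose r i (s : S i) (s' : S i.+1) :=
  forall x, pr_diff Q i (sval s' x) = sval s (pr_diff P i x).
have [|f [f0E fP]] := @dep_choice S r (exist _ f0 f0c).
  move=> i [f fc]; pose g := f \o pr_diff P i.
  have [h hP] := @projective_lift _ _ _ (pr_diff Q i) g
    (@pr_projective _ _ P i.+1)
    (fun x => bdry_to_cycle_exact x fc).
  have hc : bdry_to_cycle h by move=> x; rewrite hP /= diff_diff0 linear0.
  by exists (exist _ h hc).
exists (fun i => sval (f i)); split=> [x|i x]; last exact: fP.
by rewrite f0E f0P.
Qed.

End Comparison.

(** A chain map that covers zero on the resolved module is null-homotopic: the
    defect f - h d of a homotopy built up to some degree takes values in cycles,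
    so it lifts through the next differential.  Only the identities in positive
    degree are recorded. *)
Lemma null_homotopy (M : lmodType R) (Q : proj_resolution M)
    (f : forall i, {linear pr_mod Q i -> pr_mod Q i}) :
  (forall x, pr_aug Q (f 0 x) = 0) ->
  (forall i x, pr_diff Q i (f i.+1 x) = f i (pr_diff Q i x)) ->
  exists h : forall i, {linear pr_mod Q i -> pr_mod Q i.+1},
    forall i x, f i.+1 x = pr_diff Q i.+1 (h i.+1 x) + h i (pr_diff Q i x).
Proof.
move=> f0 fd.
have [h0 h0P] := @projective_lift _ _ _ (pr_diff Q 0) (f 0)
  (@pr_projective _ _ Q 0)
  (fun x => iffLR (pr_exact0 (f 0 x)) (f0 x)).
pose hc i (h : {linear pr_mod Q i -> pr_mod Q i.+1}) :=
  forall x, pr_diff Q i (h (pr_diff Q i x)) = f i (pr_diff Q i x).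
have h0c : hc 0%N h0 by move=> x; rewrite h0P.
pose S i := {h : {linear pr_mod Q i -> pr_mod Q i.+1} | hc i h}.
pose r i (s : S i) (s' : S i.+1) := forall x,
  f i.+1 x = pr_diff Q i.+1 (sval s' x) + sval s (pr_diff Q i x).
have [|h [h0E hP]] := @dep_choice S r (exist _ h0 h0c).
  move=> i [h hcP]; pose g := f i.+1 \- (h \o pr_diff Q i).
  have [|h' h'P] := @projective_lift _ _ _ (pr_diff Q i.+1) g
    (@pr_projective _ _ Q i.+1).
    by move=> x; apply/pr_exact; rewrite linearB /= hcP fd subrr.
  have h'c : hc i.+1 h'.
    by move=> x; rewrite h'P /= diff_diff0 linear0 subr0.
  by exists (exist _ h' h'c) => x /=; rewrite h'P subrK.
by exists (fun i => sval (h i)) => i x; apply: hP.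
Qed.

Lemma comparison_homotopy (M : lmodType R) (P Q : proj_resolution M) :
  exists (f : forall i, {linear pr_mod Q i -> pr_mod P i})
         (g : forall i, {linear pr_mod P i -> pr_mod Q i})
         (h : forall i, {linear pr_mod Q i -> pr_mod Q i.+1}),
    forall i x, g i.+1 (f i.+1 x) - x =
      pr_diff Q i.+1 (h i.+1 x) + h i (pr_diff Q i x).
Proof.
have [f [f0 fd]] := chain_map_lift Q P; have [g [g0 gd]] := chain_map_lift P Q.
exists f, g.
pose k i : {linear pr_mod Q i -> pr_mod Q i} := (g i \o f i) \- idfun.
have [x|i x|h hP] := @null_homotopy M Q k.
- by rewrite /k /= linearB /= g0 f0 subrr.
- by rewrite /k /= linearB /= gd fd.
by exists h => i x; rewrite -hP.
Qed.

End Lifting.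

(** * Free resolutions and minimality *)

Section FreeResolution.
Variables (K : fieldType) (m : nat).
Local Notation T := {mpoly K[m]}.

Lemma row_projective (R : comNzRingType) r :
  projective ('rV[R]_r : lmodType R).
Proof.
move=> M N f g f_surj.
pose a j := projT1 (cid (f_surj (g (delta_mx 0 j)))).
pose h (v : 'rV[R]_r) : M := \sum_j v 0 j *: a j.
have lin_h : linear h.
  move=> c u v; rewrite scaler_sumr -big_split; apply: eq_bigr => j _ /=.
  by rewrite !mxE scalerDl scalerA.
pose H := GRing.isLinear.Build R 'rV[R]_r M *:%R h lin_h.
exists (HB.pack h H : {linear 'rV[R]_r -> M}) => v /=.
rewrite [in RHS](row_sum_delta v) !linear_sum; apply: eq_bigr => j _.
by rewrite !linearZ /= /a; case: (cid _) => x /= ->.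
Qed.

Lemma self_projective (R : comNzRingType) : projective (R^o : lmodType R).
Proof.
move=> M N f g f_surj; have [a fa] := f_surj (g 1).
pose h (x : R^o) : M := x *: a.
have lin_h : linear h by move=> c u v; rewrite /h scalerDl scalerA.
pose H := GRing.isLinear.Build R R^o M *:%R h lin_h.
exists (HB.pack h H : {linear R^o -> M}) => x /=.
by rewrite linearZ fa -linearZ /= /GRing.scale /= mulr1.
Qed.

(** A complex resolving the ideal I, prolonged by the inclusion of I in the
    ring, is a projective resolution of the quotient by I; homological degrees
    shift by one. *)
Section Resolution.
Variables (I : submodClosed T^o) (F : free_complex K m).
Hypothesis resF : fr_resolves (I : {pred T}) F.

Definition fc_mod i : lmodType T :=
  if i is j.+1 then 'rV[T]_(fr_rank F j) else T^o.

Definition fc_aug (v : 'rV[T]_(fr_rank F 0)) : T^o := (v *m fr_aug F) 0 0.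
Lemma fc_aug_linear : linear fc_aug.
Proof. by move=> a u v; rewrite /fc_aug mulmxDl -scalemxAl !mxE. Qed.
HB.instance Definition _ :=
  GRing.isLinear.Build T 'rV[T]_(fr_rank F 0) T^o *:%R fc_aug fc_aug_linear.

Definition fc_diff i : {linear fc_mod i.+1 -> fc_mod i} :=
  match i return {linear fc_mod i.+1 -> fc_mod i} with
  | 0 => fc_aug
  | j.+1 => mulmxr (fr_diff F j)
  end.

Lemma fc_projective i : projective (fc_mod i).
Proof. by case: i => [|i]; [exact: self_projective|exact: row_projective]. Qed.

Lemma fc_surj (y : quot_mod I) : exists x, quot_proj I x = y.
Proof.
exists (repr (y : Quotient.quot (submod_pred I)))%qT; exact: quot_projK.
Qed.

Lemma fc_exact0 (x : fc_mod 0) :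
  quot_proj I x = 0 <-> exists y, x = fc_diff 0 y.
Proof.
case: resF => aug_im _ _.
rewrite -[0](linear0 (quot_proj I)) quot_proj_eq subr0; exact: aug_im.
Qed.

Lemma fc_exact i (x : fc_mod i.+1) :
  fc_diff i x = 0 <-> exists y, x = fc_diff i.+1 y.
Proof.
case: resF => _ aug_ker diff_ker; case: i x => [|i] x; last exact: diff_ker.
rewrite -[X in _ <-> X]aug_ker /= /fc_aug; split=> [x0|->]; last by rewrite mxE.
by apply/matrixP => i j; rewrite !ord1 x0 mxE.
Qed.

Definition fc_resolution : proj_resolution (quot_mod I) :=
  @ProjResolution T (quot_mod I) fc_mod fc_diff (quot_proj I) fc_projective
    fc_surj fc_exact0 fc_exact.

End Resolution.

Definition const_row r (v : 'rV[T]_r) : 'rV[K]_r := map_mx (mcoeff 0%MM) v.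

(** The matrix over K induced by h modulo the ideal of the variables. *)
Definition const_mx_of r s (h : {linear 'rV[T]_r -> 'rV[T]_s}) : 'M[K]_(r, s) :=
  \matrix_j const_row (h (delta_mx 0 j)).

Lemma const_row_linear r s (h : {linear 'rV[T]_r -> 'rV[T]_s}) v :
  const_row (h v) = const_row v *m const_mx_of h.
Proof.
rewrite [in LHS](row_sum_delta v) linear_sum /const_row raddf_sum /=.
apply/rowP => k; rewrite summxE !mxE; apply: eq_bigr => j _.
by rewrite linearZ /= !mxE rmorphM.
Qed.

Section MinimalResolution.
Variables (I : submodClosed T^o) (F : free_complex K m).
Hypothesis resF : fr_resolves (I : {pred T}) F.
Hypothesis minF : fr_minimal F.
Hypothesis properI : forall f, f \in I -> f@_0%MM = 0.

Lemma const_row_diff i v : const_row (v *m fr_diff F i) = 0.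
Proof.
rewrite /const_row map_mxM; set A := map_mx _ (fr_diff F i).
suff -> : A = 0 by rewrite mulmx0.
by apply/matrixP => p q; rewrite !mxE; apply: minF.
Qed.

(** Values of the differential are combinations of basis vectors with
    coefficients in the ideal of the variables, and a linear map preserves this
    property.  In the bottom degree the values are elements of I, whence the
    hypothesis that I is proper. *)
Lemma const_row_after_diff i (h : {linear fc_mod F i -> fc_mod F i.+1}) x :
  const_row (h (fc_diff F i x)) = 0.
Proof.
case: i h x => [|i] h x.
  have -> : h (fc_diff F 0 x) = fc_diff F 0 x *: h 1.
    by rewrite -linearZ /= /GRing.scale /= mulr1.
  apply/rowP => j; rewrite !mxE rmorphM [X in X * _]properI ?mul0r //.
  by case: resF => aug_im _ _; apply/aug_im; exists x.
by rewrite const_row_linear const_row_diff mul0mx.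
Qed.

(** The composite g f differs from the identity by d h + h d, which vanishes
    modulo the variables because F is minimal. *)
Lemma minimal_retract (P : proj_resolution (quot_mod I)) i :
  exists (f : {linear 'rV[T]_(fr_rank F i) -> pr_mod P i.+1})
         (g : {linear pr_mod P i.+1 -> 'rV[T]_(fr_rank F i)}),
    forall x, const_row (g (f x)) = const_row x.
Proof.
have [f [g [h fgh]]] := comparison_homotopy P (fc_resolution resF).
exists (f i.+1), (g i.+1) => x; apply/eqP; rewrite -subr_eq0.
have /(congr1 (@const_row _)) := fgh i x.
rewrite {1}/const_row map_mxB => ->.
rewrite {1}/const_row map_mxD [X in _ + X]const_row_after_diff addr0.
by rewrite [X in X == _]const_row_diff.
Qed.

(** The identity of a nonzero space cannot factor through zero, so a projective
    resolution is nonzero wherever a minimal one is. *)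
Lemma proj_dim_ge_rank e i :
  proj_dim_le (quot_mod I) e -> (0 < fr_rank F i)%N -> (i < e)%N.
Proof.
move=> [P P0] rank_gt0; rewrite ltnNge; apply/negP => le_ei.
have [f [g fg]] := minimal_retract P i.
have /rowP/(_ (Ordinal rank_gt0)) := fg (const_mx 1).
by rewrite (P0 i.+1 le_ei (f _)) linear0 !mxE raddf0 mcoeff1 eqxx => /esym/eqP;
  rewrite oner_eq0.
Qed.

Lemma proj_dim_le_rank d :
  (forall i, (d <= i)%N -> fr_rank F i = 0%N) -> proj_dim_le (quot_mod I) d.
Proof.
move=> rank0; exists (fc_resolution resF) => -[|i] // /rank0 /= r0.
by rewrite r0 => x; apply: thinmx0.
Qed.

End MinimalResolution.

(** By [minimal_retract] the identity matrix of size the rank of F is a product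
    over K of two matrices with inner dimension the rank of G. *)
Lemma minimal_rank_le (I : submodClosed T^o) (F G : free_complex K m) i :
  (forall f, f \in I -> f@_0%MM = 0) ->
  fr_resolves (I : {pred T}) F -> fr_minimal F ->
    fr_resolves (I : {pred T}) G ->
  (fr_rank F i <= fr_rank G i)%N.
Proof.
move=> properI resF minF resG.
have [f [g fg]] := minimal_retract resF minF properI (fc_resolution resG) i.
apply: (@mulmx1_min _ _ _ (const_mx_of f) (const_mx_of g)).
apply/row_matrixP => j; rewrite row_mul rowK -const_row_linear fg.
by apply/rowP => k; rewrite !mxE eqxx /= eq_sym mcoeffMn mcoeff1 eqxx.
Qed.

Lemma betti_minimal (I : submodClosed T^o) (F : free_complex K m) i :
  (forall f, f \in I -> f@_0%MM = 0) ->
  minimal_graded_free_resolution (I : {pred T}) F ->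
  betti (I : {pred T}) i = fr_rank F i.
Proof.
move=> properI resF; rewrite /betti.
case: pselect => [exF|]; last by case; exists F.
case: (cid exF) => G /= resG; case: resF resG => [_ resF minF] [_ resG minG].
by apply/eqP; rewrite eqn_leq !(@minimal_rank_le I).
Qed.

End FreeResolution.

(** * Division by a variable *)

Section VariableQuotient.
Variables (K : fieldType) (m : nat).
Implicit Types (f g : {mpoly K[m]}) (mu : 'X_{1..m}) (i j : 'I_m).

Lemma mcoeffMXE f mu k :
  (f * 'X_[mu])@_k = if (mu <= k)%MM then f@_(k - mu) else 0.
Proof.
case: ifPn => [le_mu_k|nle];
  first by rewrite -{1}(submK le_mu_k) addmC mcoeffMX.
apply/eqP; rewrite mcoeff_eq0 (perm_mem (msuppMX f mu)).
by apply: contra nle => /mapP[nu _ ->]; apply: lem_addr.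
Qed.

(** The quotient of f minus f at X_i = 0 by X_i: a K-linear left inverse of
    multiplication by X_i which commutes with the other variables. *)
Definition var_quo i f : {mpoly K[m]} :=
  \sum_(mu <- msupp f | (0 < mu i)%N) f@_mu *: 'X_[mu - U_(i)].

Lemma mcoeff_var_quo i f mu : (var_quo i f)@_mu = f@_(mu + U_(i)).
Proof.
rewrite /var_quo raddf_sum /=.
have mu_i : (0 < (mu + U_(i))%MM i)%N by rewrite mnmDE mnm1E eqxx addn1.
have shift (nu : 'X_{1..m}) : (0 < nu i)%N ->
  ((nu - U_(i))%MM == mu) = (nu == mu + U_(i))%MM.
  move=> nu_i; apply/eqP/eqP => [<-|->]; last by rewrite addmK.
  rewrite submK //; apply/mnm_lepP => j; rewrite mnm1E.
  by case: eqP => // <-.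
have [in_f|] := boolP ((mu + U_(i))%MM \in msupp f).
  rewrite big_mkcond (bigD1_seq (mu + U_(i))%MM) //= mu_i big1 => [|nu neq].
    by rewrite addr0 mcoeffZ mcoeffX addmK eqxx mulr1.
  by case: ifP => // nu_i; rewrite mcoeffZ mcoeffX shift // (negbTE neq) mulr0.
rewrite -mcoeff_eq0 => /eqP f0; rewrite f0 big1_seq // => nu /andP[nu_i _].
rewrite mcoeffZ mcoeffX shift //.
by case: eqP => [->|_]; rewrite ?f0 (mul0r, mulr0).
Qed.

Lemma var_quo_is_linear i : linear (var_quo i).
Proof.
move=> a f g; apply/mpolyP => mu.
by rewrite mcoeffD mcoeffZ !mcoeff_var_quo mcoeffD mcoeffZ.
Qed.
HB.instance Definition _ i := GRing.isLinear.Build K {mpoly K[m]} {mpoly K[m]}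
  _ (var_quo i) (var_quo_is_linear i).

Lemma var_quoC i j f : var_quo i (var_quo j f) = var_quo j (var_quo i f).
Proof.
by apply/mpolyP => mu; rewrite !mcoeff_var_quo -!addmA [(U_(i) + _)%MM]addmC.
Qed.

Lemma var_quoK i : cancel ( *%R 'X_i) (var_quo i).
Proof.
by move=> f; apply/mpolyP => mu; rewrite mcoeff_var_quo mulrC addmC mcoeffMX.
Qed.

Lemma var_quoXM i j f : i != j -> var_quo i ('X_j * f) = 'X_j * var_quo i f.
Proof.
move=> neq; apply/mpolyP => mu;
  rewrite mcoeff_var_quo 2!['X_j * _]mulrC !mcoeffMXE.
have e k : ((mu + U_(i))%MM k = mu k + (i == k))%N by rewrite mnmDE mnm1E.
have -> : (U_(j) <= mu + U_(i))%MM = (U_(j) <= mu)%MM.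
  apply/mnm_lepP/mnm_lepP => le k; have := le k; rewrite e mnm1E.
    by have [<-|] := eqVneq j k; rewrite // (negbTE neq) addn0.
  by move/leq_trans; apply; apply: leq_addr.
case: ifP => // /mnm_lepP le; rewrite mcoeff_var_quo; congr (_ @_ _).
apply/mnmP => k; rewrite mnmBE e mnmDE mnmBE !mnm1E addnBAC //.
by have := le k; rewrite mnm1E.
Qed.

End VariableQuotient.

(** * The cubical complex of the independent sets *)

Section Chains.
Variables (K : fieldType) (n : nat).
Local Notation T := {mpoly K[n + n]}.
Local Notation chain := ({set 'I_n} -> {set 'I_n} -> T).
Implicit Types (S A : {set 'I_n}) (x y : 'I_n) (v w u : chain).

(** The sign of moving x to its place in the increasing list of x |: A. *)
Definition sgn x A : T := (-1) ^+ #|[set y in A | (y < x)%N]|.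

Lemma sgnU x y A : y \notin A -> sgn x (y |: A) = (-1) ^+ (y < x)%N * sgn x A.
Proof.
move=> yA; rewrite /sgn -exprD; congr (_ ^+ _).
have [lt_yx|ge_yx] := boolP (y < x)%N.
  suff -> : [set z in y |: A | (z < x)%N] = y |: [set z in A | (z < x)%N].
    by rewrite cardsU1 inE (negbTE yA).
  by apply/setP => z; rewrite !inE; case: eqP => // ->; rewrite lt_yx.
apply: eq_card => z; rewrite !inE; case: eqP => // ->.
by rewrite (negbTE ge_yx) !andbF.
Qed.

Lemma sgn_sqr x A : sgn x A * sgn x A = 1.
Proof. by rewrite -expr2 sqrr_sign. Qed.

Lemma sgn_swap x y A : x != y -> x \notin A -> y \notin A ->
  sgn x A * sgn y (x |: A) = - (sgn y A * sgn x (y |: A)).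
Proof.
move=> neq xA yA; rewrite !sgnU //.
have : val x != val y by [].
by rewrite neq_ltn => /orP[] lt; rewrite lt ltnNge (ltnW lt) /= expr0 expr1;
  ring.
Qed.

Lemma sgn_swap_both x y A : x != y -> x \notin A -> y \notin A ->
  sgn x (y |: A) * sgn y (x |: A) = - (sgn x A * sgn y A).
Proof.
move=> neq xA yA; rewrite !sgnU //.
have : val x != val y by [].
by rewrite neq_ltn => /orP[] lt; rewrite lt ltnNge (ltnW lt) /= expr0 expr1;
  ring.
Qed.

Definition face_coef x S : T := if x \in S then tvar K x else - svar K x.

Lemma face_coefU x y S : x != y -> face_coef x (y |: S) = face_coef x S.
Proof. by move=> /negbTE neq; rewrite /face_coef in_setU1 neq. Qed.

(** Chains are given by their coefficients, so the boundary is written through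
    the cofaces of (S, A): for x in S these are the (S, x |: A), whose facet
    (S, A) comes with t_x; for x outside S they are the (x |: S, x |: A), with
    coefficient - s_x.  The formula is uniform because x |: S = S for x in S. *)
Definition boundary v : chain := fun S A =>
  \sum_(x | x \notin A) sgn x A * face_coef x S * v (x |: S) (x |: A).

Lemma boundaryD v w S A : boundary (fun S A => v S A + w S A) S A =
  boundary v S A + boundary w S A.
Proof.
by rewrite /boundary -big_split; apply: eq_bigr => x _; rewrite mulrDr.
Qed.

(** The terms adding x then y and y then x cancel: the coefficients of x and y
    do not depend on the order, and the sign changes. *)
Lemma boundary_boundary v S A : boundary (boundary v) S A = 0.
Proof.
rewrite /boundary; under eq_bigr => x _ do rewrite mulr_sumr.
pose F x y := sgn x A * face_coef x S * (sgn y (x |: A) * face_coef y (x |: S) *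
  v (y |: (x |: S)) (y |: (x |: A))).
have Fanti x y : x != y -> x \notin A -> y \notin A -> F x y = - F y x.
  move=> neq xA yA; have neq' : y != x by rewrite eq_sym.
  rewrite /F ![y |: (x |: _)]setUCA (face_coefU _ neq) (face_coefU _ neq').
  have := sgn_swap neq xA yA;
    move: (sgn x A) (sgn y (x |: A)) (sgn y A) (sgn x (y |: A)).
  move=> a b c d e; transitivity (a * b * face_coef x S * face_coef y S *
    v (x |: (y |: S)) (x |: (y |: A))); first by ring.
  by rewrite e; ring.
pose P (p : 'I_n * 'I_n) := (p.1 \notin A) && (p.2 \notin p.1 |: A).
have PE p : P p = [&& p.1 != p.2, p.1 \notin A & p.2 \notin A].
  by rewrite /P in_setU1 negb_or eq_sym andbCA.
transitivity (\sum_(p | P p) F p.1 p.2); first by rewrite pair_big_dep.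
(* Match the pair (x, y) with x < y and the pair (y, x). *)
rewrite (bigID (fun p : 'I_n * 'I_n => (p.1 < p.2)%N)) /=.
rewrite [X in _ + X](reindex_inj (h := fun p : 'I_n * 'I_n => (p.2, p.1))) /=;
  last first.
  by move=> [a b] [c d] [-> ->].
apply/eqP; rewrite addr_eq0 -sumrN; apply/eqP; apply: eq_big => -[x y] /=.
  rewrite -[LHS]/(P (x, y) && _) -[RHS]/(P (y, x) && _) !PE /= eq_sym -leqNgt.
  have [->|neq] := eqVneq x y => //=.
  by rewrite [(y \notin A) && _]andbC ltn_neqAle [_ == _ :> nat]val_eqE neq.
rewrite -[X in X && _]/(P (x, y)) PE /= => /andP[/and3P[neq xA yA] _].
exact: Fanti.
Qed.

Definition tquo x : T -> T := var_quo (rshift n x).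
HB.instance Definition _ x := GRing.Linear.on (tquo x).

Lemma tquo_tvar x f : tquo x (tvar K x * f) = f.
Proof. exact: var_quoK. Qed.

Lemma tquo_svar x y f : tquo x (svar K y * f) = svar K y * tquo x f.
Proof. by apply: var_quoXM; rewrite eq_sym eq_lrshift. Qed.

Lemma tquo_tvarM x y f : x != y -> tquo x (tvar K y * f) = tvar K y * tquo x f.
Proof. by move=> neq; apply: var_quoXM; rewrite (inj_eq (@rshift_inj _ _)). Qed.

Lemma tquo_face_coef x y S f : x != y ->
  tquo x (face_coef y S * f) = face_coef y S * tquo x f.
Proof.
move=> neq; rewrite /face_coef; case: ifP => _; first exact: tquo_tvarM.
by rewrite !mulNr raddfN /= tquo_svar.
Qed.

Lemma tquo_sgn x y A f : tquo x (sgn y A * f) = sgn y A * tquo x f.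
Proof. exact: raddfMsign. Qed.

(** In direction x the complex is a segment: an edge, where x is in A, between the
    end with x in S but not in A and the end with x outside S.  The contraction
    lifts the first end to the edge, dividing its coefficient by t_x. *)
Definition homotopy x v : chain := fun S A =>
  if (x \in A) && (x \in S) then sgn x (A :\ x) * tquo x (v S (A :\ x)) else 0.

(** What the contraction in direction x leaves: nothing on the edge, and on the
    end with x in S the part of the coefficient free of t_x; the rest, divided
    by t_x and multiplied by s_x, is pushed to the end with x outside S. *)
Definition collapse x v : chain := fun S A =>
  if x \in A then 0
  else if x \in S then v S A - tvar K x * tquo x (v S A)
  else v S A + svar K x * tquo x (v (x |: S) A).

(** The terms in the directions y other than x cancel between d h_x and h_x d,
    by the sign rule and because division by t_x commutes with s_y and t_y. What
    remains is the direction x alone, where the complex has length one. *)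
Lemma homotopy_identity x v S A : (forall S A, ~~ (A \subset S) -> v S A = 0) ->
  boundary (homotopy x v) S A + homotopy x (boundary v) S A =
    v S A - collapse x v S A.
Proof.
move=> v0; rewrite [homotopy x (boundary v) _ _]/homotopy /collapse.
have [xA|xA] /= := boolP (x \in A); last first.
  rewrite addr0 /boundary (bigD1 x) //= big1 => [|y /andP[yA neq]]; last first.
    by rewrite /homotopy in_setU1 eq_sym (negbTE neq) (negbTE xA) mulr0.
  rewrite addr0 /homotopy !setU11 /= setU1K // mulrACA sgn_sqr mul1r /face_coef.
  case: ifPn => xS; last by rewrite mulNr; ring.
  by rewrite (setUidPr _) ?sub1set //; ring.
have [xS|xS] := boolP (x \in S); last first.
  rewrite subr0 addr0 [RHS]v0; last by apply: contra xS => /subsetP; apply.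
  rewrite /boundary big1 // => y yA;
    rewrite /homotopy !in_setU1 xA orbT (negbTE xS) orbF /=.
  by case: eqP => [xy|_]; [rewrite -xy xA in yA | rewrite mulr0].
rewrite subr0 [boundary v _ _]/boundary (bigD1 x) /= ?setD11 // raddfD /=
  mulrDr.
rewrite setD1K // (setUidPr _) ?sub1set //.
rewrite -[sgn _ _ * _ * _]mulrA tquo_sgn mulrA sgn_sqr mul1r {1}/face_coef xS
  tquo_tvar.
(* The direction x gives v S A; the other directions cancel in pairs. *)
rewrite addrCA -[RHS]addr0; congr (_ + _).
rewrite raddf_sum mulr_sumr /boundary.
rewrite [X in _ + X](eq_bigl (fun y => y \notin A)); last first.
  by move=> y; rewrite !inE negb_and negbK; have [->|_] := eqVneq y x;
    rewrite ?xA ?andbF ?andbT.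
rewrite -big_split big1 // => y yA.
have neq : x != y by apply: contraNneq yA => <-.
have xB : x \notin A :\ x by rewrite !inE eqxx.
have yB : y \notin A :\ x by rewrite !inE negb_and yA orbT.
rewrite /homotopy !in_setU1 xA xS !orbT /=.
have -> : (y |: A) :\ x = y |: (A :\ x).
  by apply/setP => z; rewrite !inE; have [->|] := eqVneq z y;
    rewrite //= eq_sym neq.
rewrite -[sgn y (A :\ x) * _ * _]mulrA tquo_sgn tquo_face_coef //.
rewrite -{1}(setD1K xA).
have := sgn_swap_both neq xB yB; set B := A :\ x.
move: (sgn x B) (sgn y (x |: B)) (sgn y B) (sgn x (y |: B)) => a b c d e.
set f := tquo _ _.
transitivity ((d * b + a * c) * (face_coef y S * f)); first by ring.
by rewrite e addNr mul0r.
Qed.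

Variable adj : rel 'I_n.

Lemma independent_sub S S' :
  S' \subset S -> independent adj S -> independent adj S'.
Proof.
move=> /subsetP sub /forallP indS; apply/forallP => i; apply/implyP => iS.
apply/forallP => j; apply/implyP => jS.
by have /implyP/(_ (sub _ iS))/forallP/(_ j)/implyP/(_ (sub _ jS)) := indS i.
Qed.

Definition cell (i : nat) : pred ({set 'I_n} * {set 'I_n}) := fun c =>
  [&& independent adj c.1, c.2 \subset c.1 & #|c.2| == i].

Definition supported i v := forall S A, ~~ cell i (S, A) -> v S A = 0.

(** Facets stay in the complex because subsets of independent sets are
    independent. *)
Lemma cellU1 i x S A : x \notin A ->
  cell i.+1 (x |: S, x |: A) -> cell i (S, A).
Proof.
move=> xA /and3P[/= ind sub card]; apply/and3P; split=> /=.
- exact: independent_sub (subsetUr _ _) ind.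
- apply/subsetP => y yA; have /subsetP/(_ y) := sub.
  rewrite !in_setU1 yA orbT => /(_ isT).
  by have [yx|_] := eqVneq y x; first by rewrite -yx yA in xA.
- by rewrite cardsU1 xA in card.
Qed.

Lemma supported_boundary i v : supported i.+1 v -> supported i (boundary v).
Proof.
move=> vi S A nc; rewrite /boundary big1 // => x xA.
by rewrite vi ?mulr0 //; apply: contra nc; apply: cellU1.
Qed.

Lemma supported_homotopy i x v : supported i v -> supported i.+1 (homotopy x v).
Proof.
move=> vi S A nc; rewrite /homotopy; case: ifP => // /andP[xA xS].
rewrite vi ?raddf0 ?mulr0 //; apply: contra nc => /and3P[/= ind sub card].
apply/and3P; split=> //=; last by rewrite (cardsD1 x) xA add1n.
by rewrite -(setD1K xA) subUset sub1set xS.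
Qed.

Lemma supported_collapse i x v : supported i v -> supported i (collapse x v).
Proof.
move=> vi S A nc; rewrite /collapse; case: ifPn => // xA.
case: ifP => [xS|xS]; rewrite vi // ?raddf0 ?mulr0 ?subr0 // add0r vi ?raddf0
  ?mulr0 //.
apply: contra nc => /and3P[/= ind sub card]; apply/and3P; split=> //=.
  exact: independent_sub (subsetUr _ _) ind.
by rewrite -(setU1K (negbT xS)) subsetD1 sub.
Qed.

Lemma supported_sub i v S A : supported i v -> ~~ (A \subset S) -> v S A = 0.
Proof. by move=> vi nsub; apply: vi; rewrite /cell (negbTE nsub) andbF. Qed.

(** The shape of a chain in which the directions in s have been collapsed. *)
Definition reduced (s : seq 'I_n) v := forall x S A, x \in s ->
  (x \in A -> v S A = 0) /\ (x \in S -> tquo x (v S A) = 0).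

(** Divisions by two variables commute, so collapsing in direction x keeps the
    directions that were collapsed before. *)
Lemma reduced_collapse s x v : reduced s v -> reduced (x :: s) (collapse x v).
Proof.
move=> red y S A; rewrite inE /collapse => /predU1P[->|ys].
  split=> [->//|xS]; case: ifP => [_|xA]; first exact: raddf0.
  by rewrite xS raddfB /= tquo_tvar subrr.
split=> [yA|yS].
  case: ifP => // _; have [/(_ yA) -> _] := red y S A ys.
  have [/(_ yA) -> _] := red y (x |: S) A ys.
  by rewrite raddf0 !mulr0 subr0 addr0 if_same.
case: ifP => [_|_]; first exact: raddf0.
have [_ /(_ yS) r1] := red y S A ys.
have [_ r2] := red y (x |: S) A ys.
have yxS : y \in x |: S by rewrite in_setU1 yS orbT.
case: ifP => xS.
  have [->|neq] := eqVneq y x; first by rewrite raddfB /= tquo_tvar subrr.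
  by rewrite raddfB /= tquo_tvarM // r1 /tquo var_quoC -/(tquo y _) r1 raddf0
    mulr0 subr0.
by rewrite raddfD /= tquo_svar r1 /tquo var_quoC -/(tquo y _) r2 // raddf0
  mulr0 addr0.
Qed.

(** On a cycle, v - collapse x v = d h_x v is a boundary, so that the collapsed
    chain is again a cycle in the same class. *)
Lemma reduce_cycle i v (s : seq 'I_n) :
  supported i v -> (forall S A, boundary v S A = 0) ->
  exists w, supported i.+1 w /\
    exists u, [/\ supported i u, reduced s u &
      forall S A, v S A = u S A + boundary w S A].
Proof.
move=> vi dv; elim: s => [|x s [w [wi [u [ui red vE]]]]].
  exists (fun _ _ => 0); split=> //; exists v; split=> // S A.
  by rewrite /boundary big1 ?addr0 // => x _; rewrite mulr0.
have du S A : boundary u S A = 0.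
  have : boundary v S A = boundary (fun S A => u S A + boundary w S A) S A.
    by apply: eq_bigr => y _; rewrite vE.
  by rewrite boundaryD boundary_boundary addr0 dv.
exists (fun S A => w S A + homotopy x u S A); split.
  by move=> S A nc; rewrite wi // (supported_homotopy x ui) // addr0.
exists (collapse x u); split; first exact: supported_collapse.
  exact: reduced_collapse.
move=> S A; rewrite boundaryD vE.
have := homotopy_identity x S A (fun S A => @supported_sub i u S A ui).
have -> : homotopy x (boundary u) S A = 0.
  by rewrite /homotopy; case: ifP => // _; rewrite du raddf0 mulr0.
by rewrite addr0 => ->; ring.
Qed.

Lemma boundary_exact i v : supported i.+1 v ->
  (forall S A, boundary v S A = 0) ->
  exists2 w, supported i.+2 w & forall S A, v S A = boundary w S A.
Proof.
move=> vi dv; have [w [wi [u [ui red vE]]]] := reduce_cycle (enum 'I_n) vi dv.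
exists w => // S A; rewrite vE; suff -> : u S A = 0 by rewrite add0r.
have [c|/ui //] := boolP (cell i.+1 (S, A)).
have /card_gt0P[x xA] : (0 < #|A|)%N by case/and3P: c => _ _ /= /eqP ->.
by have [|-> //] := red x S A; rewrite ?mem_enum.
Qed.

Lemma boundary_deg0 v : supported 0 v -> forall S A, boundary v S A = 0.
Proof.
move=> v0 S A; rewrite /boundary big1 // => x xA; rewrite v0 ?mulr0 //.
by rewrite /cell /= cardsU1 xA !andbF.
Qed.

Definition augmentation v : T :=
  \sum_(S : {set 'I_n}) v S set0 * indep_monomial K S.

(** For x outside S, s_x m_S = t_x m_(x |: S) holds because both products carry
    s_x and t_x; these are the two ends of each edge. *)
Lemma augmentation_boundary v : augmentation (boundary v) = 0.
Proof.
rewrite /augmentation; under eq_bigr => S _ do rewrite mulr_suml.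
rewrite exchange_big big1 // => x; rewrite in_set0 => _.
rewrite (bigID (fun S : {set 'I_n} => x \in S)) /=.
rewrite [X in X + _](reindex_onto (fun S => x |: S) (fun S => S :\ x)) /=;
  last first.
  by move=> S; apply: setD1K.
apply/eqP; rewrite addr_eq0 -sumrN; apply/eqP; apply: eq_big => S.
  rewrite setU11; apply/eqP/idP => [<-|]; [by rewrite setD11 | exact: setU1K].
rewrite setU11 => /eqP SE; have xS : x \notin S by rewrite -SE setD11.
rewrite /face_coef setU11 (negbTE xS) setUA setUid /indep_monomial.
rewrite big_setU1 //= (bigD1 x (P := fun r => r \in ~: S)) ?inE //=.
rewrite [X in _ * _ * (_ * X) = _](_ : _ = \prod_(r in ~: (x |: S)) tvar K r);
  last by [].
rewrite [X in _ = - (_ * (_ * (_ * X)))](_ : _ =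
  \prod_(r in ~: (x |: S)) tvar K r); last first.
  by apply: eq_bigl => r; rewrite !inE negb_or andbC.
ring.
Qed.

Definition set_mnm S : 'X_{1..n + n} :=
  (\sum_(r in S) U_(lshift n r) + \sum_(r in ~: S) U_(rshift n r))%MM.

Lemma indep_monomialE S : indep_monomial K S = 'X_[set_mnm S].
Proof.
by rewrite /indep_monomial /set_mnm mpolyXD
  !(big_morph (fun mu => 'X_[mu]) (@mpolyXD _ _) (@mpolyX0 _ _)).
Qed.

Lemma set_mnm_t S x : set_mnm S (rshift n x) = (x \notin S).
Proof.
rewrite mnmDE !mnm_sumE big1 ?add0n => [|r _]; last by rewrite mnm1E eq_lrshift.
under eq_bigr => r _ do rewrite mnm1E (inj_eq (@rshift_inj _ _)).
rewrite big_mkcond (bigD1 x) //= eqxx inE big1 ?addn0; first by case: (x \in S).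
by move=> r /negbTE ->; rewrite if_same.
Qed.

Lemma mdeg_set_mnm S : mdeg (set_mnm S) = n.
Proof.
have deg1 (B : {set 'I_n}) (h : 'I_n -> 'I_(n + n)) :
    mdeg (\sum_(r in B) U_(h r))%MM = #|B|.
  by rewrite mdeg_sum -sum1_card; apply: eq_bigr => r _; rewrite mdeg1.
by rewrite mdegD !deg1 cardsC card_ord.
Qed.

(** For reduced v, the set S can be read off any monomial of v S set0 * m_S: its
    elements are the x for which t_x does not occur.  Hence monomials for
    different S never cancel. *)
Lemma augmentation_reduced_eq0 v : reduced (enum 'I_n) v ->
  augmentation v = 0 ->
  forall S, v S set0 = 0.
Proof.
move=> red aug0 S0; apply/mpolyP => k; rewrite mcoeff0.
have tfree S x (mu : 'X_{1..n + n}) : x \in S -> (0 < mu (rshift n x))%N ->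
  (v S set0)@_mu = 0.
  move=> xS mu_x; have [_ /(_ xS) r] := red x S set0 (mem_enum _ x).
  have le : (U_(rshift n x) <= mu)%MM.
    by apply/mnm_lepP => j; rewrite mnm1E; case: eqP => // <-.
  by rewrite -(submK le) -mcoeff_var_quo -/(tquo x _) r mcoeff0.
have [x /andP[xS kx]|k0] :=
  pickP (fun x => (x \in S0) && (0 < k (rshift n x))%N).
  exact: tfree xS kx.
(* No t_x with x in S0 occurs in k, so k * m_S0 determines S0 and cannot occur
   in the summand of another S. *)
have /(congr1 (mcoeff (set_mnm S0 + k)%MM)) := aug0.
rewrite /augmentation raddf_sum (bigD1 S0) //= indep_monomialE mcoeffMX mcoeff0.
rewrite big1 ?addr0 // => S neq; rewrite indep_monomialE mcoeffMXE.
have kE x : (set_mnm S0 + k)%MM (rshift n x) =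
  ((x \notin S0) + k (rshift n x))%N.
  by rewrite mnmDE set_mnm_t.
case: ifP => // /mnm_lepP le.
have [sub|/subsetPn[x xS xS0]] := boolP (S \subset S0); last first.
  apply: (tfree S x) => //.
  by rewrite mnmBE kE set_mnm_t xS xS0 /= subn0 add1n.
have : ~~ (S0 \subset S) by apply: contra neq => sub'; rewrite eqEsubset sub.
case/subsetPn => x xS0 xS; have := le (rshift n x); have := k0 x.
by rewrite kE set_mnm_t xS0 xS /= add0n => ->.
Qed.

Lemma augmentation_exact v : supported 0 v -> augmentation v = 0 ->
  exists2 w, supported 1 w & forall S A, v S A = boundary w S A.
Proof.
move=> v0 av; have dv := boundary_deg0 v0.
have [w [w1 [u [u0 red vE]]]] := reduce_cycle (enum 'I_n) v0 dv.
exists w => // S A; rewrite vE; suff -> : u S A = 0 by rewrite add0r.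
have [/and3P[_ _]|/u0 //] := boolP (cell 0 (S, A)).
rewrite /= cards_eq0 => /eqP ->; apply: augmentation_reduced_eq0 => //.
rewrite -av; transitivity (augmentation (fun S A => u S A + boundary w S A));
  last first.
  by apply: eq_bigr => S' _; rewrite vE.
rewrite /augmentation; under [RHS]eq_bigr => S' _ do rewrite mulrDl.
by rewrite big_split /= -/(augmentation (boundary w)) augmentation_boundary
  addr0.
Qed.

Definition cells i := [set c | cell i c].

Definition basis_chain i (p : 'I_#|cells i|) : chain := fun S A =>
  (enum_val p == (S, A))%:R.

(** The basis of degree i is the list of the pairs (S, A) with #|A| = i, and all
    of them have degree n + i, the resolution being linear. *)
Definition indep_complex : free_complex K (n + n) := {|
  fr_rank i := #|cells i|;
  fr_deg i _ := (n + i)%:Z;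
  fr_diff i := \matrix_(p, q)
    boundary (basis_chain p) (enum_val q).1 (enum_val q).2;
  fr_aug := \col_p indep_monomial K (enum_val p).1
|}.

Definition chain_of i (v : 'rV[T]_#|cells i|) : chain := fun S A =>
  \sum_p v 0 p * basis_chain p S A.

Definition row_of i v : 'rV[T]_#|cells i| :=
  \row_q v (enum_val q).1 (enum_val q).2.

Lemma chain_of_enum i (v : 'rV[T]_#|cells i|) q :
  chain_of v (enum_val q).1 (enum_val q).2 = v 0 q.
Proof.
rewrite /chain_of (bigD1 q) //= big1 => [|p neq].
  by rewrite addr0 /basis_chain -surjective_pairing eqxx mulr1.
rewrite /basis_chain -surjective_pairing (inj_eq enum_val_inj) (negbTE neq).
by rewrite mulr0.
Qed.

Lemma chain_of_supported i (v : 'rV[T]_#|cells i|) : supported i (chain_of v).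
Proof.
move=> S A nc; rewrite /chain_of big1 // => p _; rewrite /basis_chain.
case: eqP => [pE|_]; last by rewrite mulr0.
by have := enum_valP p; rewrite pE inE (negbTE nc).
Qed.

Lemma row_ofK i v : supported i v ->
  forall S A, chain_of (row_of i v) S A = v S A.
Proof.
move=> vi S A; have [c|nc] := boolP (cell i (S, A)); last first.
  by rewrite vi // chain_of_supported.
have cS : (S, A) \in cells i by rewrite inE.
have := chain_of_enum (row_of i v) (enum_rank_in cS (S, A)).
by rewrite mxE !enum_rankK_in.
Qed.

Lemma chain_of_inj i (v w : 'rV[T]_#|cells i|) :
  (forall S A, chain_of v S A = chain_of w S A) -> v = w.
Proof. by move=> vw; apply/rowP => q; rewrite -!chain_of_enum vw. Qed.

Lemma chain_of_diff i (v : 'rV[T]_#|cells i.+1|) S A :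
  chain_of (v *m fr_diff indep_complex i) S A = boundary (chain_of v) S A.
Proof.
rewrite -(row_ofK (supported_boundary (chain_of_supported v)) S A).
congr (chain_of _ S A); apply/rowP => q; rewrite !mxE /boundary /chain_of.
under eq_bigr => p _ do rewrite mxE /boundary mulr_sumr.
rewrite exchange_big; apply: eq_bigr => x _; rewrite mulr_sumr.
by apply: eq_bigr => p _; rewrite mulrCA.
Qed.

Lemma augmentation_chain_of (v : 'rV[T]_#|cells 0|) :
  (v *m fr_aug indep_complex) 0 0 = augmentation (chain_of v).
Proof.
rewrite mxE /augmentation;
  under [RHS]eq_bigr => S _ do rewrite /chain_of mulr_suml.
rewrite exchange_big; apply: eq_bigr => p _; rewrite mxE.
have := enum_valP p; rewrite inE => /and3P[_ _]; rewrite cards_eq0 => /eqP pA.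
rewrite (bigD1 (enum_val p).1) //= big1 => [|S neq]; rewrite /basis_chain.
  by rewrite addr0 -pA -surjective_pairing eqxx mulr1.
rewrite [enum_val p]surjective_pairing xpair_eqE eq_sym (negbTE neq).
by rewrite mulr0 mul0r.
Qed.

(** Everything is transported through [chain_of] from the exactness statements
    for chains. *)
Lemma indep_complex_resolves :
  fr_resolves (indep_ideal K adj) indep_complex.
Proof.
split=> [f|v|i v].
- split=> [/asboolP[s [sG ->]]|[v ->]].
    elim: s sG => [|[a g] s IHs] sG.
      by exists 0; rewrite big_nil mul0mx mxE.
    have [|v vE] := IHs; first by move=> x xs; apply: sG; rewrite inE xs orbT.
    have [S indS /= ->] := sG _ (mem_head _ _).
    have c0 : (S, set0) \in cells 0 by rewrite inE /cell /= indS sub0set cards0.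
    exists (a *: delta_mx 0 (enum_rank_in c0 (S, set0)) + v).
    rewrite big_cons vE mulmxDl -scalemxAl -rowE [RHS]mxE; congr (_ + _).
    by rewrite !mxE enum_rankK_in.
  rewrite mxE; apply: (rpred_sum (S := indep_ideal K adj)) => p _.
  apply: (rpredZ (s := indep_ideal K adj)); rewrite mxE.
  apply/asboolP; exists [:: (1, indep_monomial K (enum_val p).1)].
  split=> [x|]; last by rewrite big_seq1 scale1r.
  rewrite inE => /eqP -> /=; exists (enum_val p).1 => //.
  by have := enum_valP p; rewrite inE => /and3P[].
- split=> [v0|[w ->]].
    have := augmentation_chain_of v; rewrite v0 mxE => /esym.
    case/(augmentation_exact (chain_of_supported v)) => w w1 vE.
    exists (row_of 1 w); apply: chain_of_inj => S A.
    rewrite chain_of_diff vE; apply: eq_bigr => x _.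
    by rewrite row_ofK.
  apply/matrixP => a b; rewrite !ord1 augmentation_chain_of mxE
    -(augmentation_boundary (chain_of w)).
  by apply: eq_bigr => S _; rewrite chain_of_diff.
split=> [v0|[w ->]].
  have dv S A : boundary (chain_of v) S A = 0.
    by rewrite -chain_of_diff v0 /chain_of big1 // => p _; rewrite mxE mul0r.
  have [w w2 vE] := boundary_exact (chain_of_supported v) dv.
  exists (row_of i.+2 w); apply: chain_of_inj => S A.
  rewrite chain_of_diff vE; apply: eq_bigr => x _.
  by rewrite row_ofK.
apply: chain_of_inj => S A; rewrite chain_of_diff.
transitivity (boundary (boundary (chain_of w)) S A).
  by apply: eq_bigr => x _; rewrite chain_of_diff.
by rewrite boundary_boundary /chain_of big1 // => p _; rewrite mxE mul0r.
Qed.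

Lemma indep_complex_diff_homog i p q :
  fr_diff indep_complex i p q \is 1.-homog.
Proof.
rewrite mxE /boundary rpred_sum // => x _.
rewrite -mulrA /sgn -signr_odd mulr_sign; case: odd;
  rewrite ?rpredN /basis_chain.
all: case: eqP => _; rewrite ?mulr0 ?mulr1 ?rpred0 // /face_coef;
  case: ifP => _.
all: by rewrite ?rpredN dhomogX; apply/eqP/mdeg1.
Qed.

Lemma indep_complex_minimal_resolution :
  minimal_graded_free_resolution (indep_ideal K adj) indep_complex.
Proof.
split; last 2 first.
- exact: indep_complex_resolves.
- move=> i p q; apply: (dhomog_nemf_coeff (indep_complex_diff_homog p q)).
  by rewrite /= mdeg0.
split=> [p mu|i p q mu].
  by rewrite mxE indep_monomialE msuppX inE => /eqP ->;
    rewrite mdeg_set_mnm /= addn0.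
move/(dhomog_mf (indep_complex_diff_homog p q)) => /= ->.
by rewrite addnS.
Qed.

Lemma indep_ideal_const0 f : (0 < n)%N -> f \in indep_ideal K adj ->
  f@_0%MM = 0.
Proof.
move=> n_gt0 /asboolP[s [sG ->]];
  rewrite raddf_sum big_seq big1 // => x /sG[S _ ->].
rewrite /GRing.scale /= indep_monomialE mcoeffMXE; case: ifP => // /mnm_lepP le.
suff : mdeg (set_mnm S) = 0%N.
  by rewrite mdeg_set_mnm => n0; rewrite n0 in n_gt0.
by rewrite mdegE big1 // => j _; have := le j; rewrite mnm0E leqn0 => /eqP.
Qed.

Lemma card_cells i :
  #|cells i| = (\sum_(S : {set 'I_n} | independent adj S) 'C(#|S|, i))%N.
Proof.
transitivity (\sum_(c : {set 'I_n} * {set 'I_n} | (independent adj c.1) &&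
  ((c.2 \subset c.1) && (#|c.2| == i))) 1)%N.
  by rewrite -sum1_card; apply: eq_bigl => c; rewrite inE.
rewrite -(pair_big_dep (fun S => independent adj S)
  (fun S A : {set 'I_n} => (A \subset S) && (#|A| == i)) (fun _ _ => 1%N)) /=.
apply: eq_bigr => S _; rewrite sum1_card -cards_draws.
by apply: eq_card => A; rewrite !inE.
Qed.

End Chains.

(** * Independent sets of cycles as cyclic words *)

Section SparseBitSequences.
Local Open Scope nat_scope.

Fixpoint bitseqs n : seq bitseq :=
  if n is n'.+1 then
    [seq true :: s | s <- bitseqs n'] ++ [seq false :: s | s <- bitseqs n']
  else [:: [::]].

Lemma mem_bitseqs n s : (s \in bitseqs n) = (size s == n).
Proof.
elim: n s => [|n IHn] [|b s] //=.
- by apply/negbTE; rewrite mem_cat; apply/norP; split; apply/mapP => -[].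
- rewrite mem_cat eqSS -IHn;
  apply/idP/idP => [/orP[] /mapP[t t_in [_ ->]] //|s_in].
  by case: b; apply/orP; [left | right]; apply/mapP; exists s.
Qed.

Lemma uniq_bitseqs n : uniq (bitseqs n).
Proof.
elim: n => // n IHn; rewrite /= cat_uniq !map_inj_uniq ?IHn;
  try by move=> ? ? [].
by rewrite /= andbT; apply/hasPn => _ /mapP[s _ ->]; apply/mapP => -[].
Qed.

Lemma card_tuple_bitseqs n (p : pred bitseq) :
  #|[set t : n.-tuple bool | p t]| = count p (bitseqs n).
Proof.
rewrite cardsE cardE /enum_mem size_filter -enumT.
rewrite -(count_map (@tval n bool) p); apply/permP/uniq_perm.
- by rewrite map_inj_uniq ?enum_uniq //; apply: val_inj.
- exact: uniq_bitseqs.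
move=> s; rewrite mem_bitseqs; apply/mapP/eqP => [[t _ ->]|s_n].
  exact: size_tuple.
by exists (tcast s_n (in_tuple s)); rewrite ?mem_enum ?val_tcast.
Qed.

Definition sparse : rel bool := fun a b => ~~ (a && b).

(** The words of length n with k ones that can be inserted between the letters a
    and b without creating two consecutive ones. *)
Definition sparse_count n k a b :=
  count (fun s => (count_mem true s == k) && path sparse a (rcons s b))
    (bitseqs n).

Lemma sparse_countS n k a b :
  sparse_count n.+1 k a b =
    ((if a then 0 else if k is k'.+1 then sparse_count n k' true b else 0) +
     sparse_count n k false b)%N.
Proof.
rewrite /sparse_count /= count_cat !count_map; congr addn; last first.
  by apply: eq_count => s; case: a.
case: a => [|].
  by rewrite (eq_count (a2 := pred0)) ?count_pred0 // => s /=; rewrite andbF.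
case: k => [|k]; last by apply: eq_count => s.
by rewrite (eq_count (a2 := pred0)) ?count_pred0 // => s.
Qed.

(** The joint induction is Pascal's rule for the first letter; truncated
    subtraction gives the right value 0 for k large. *)
Lemma sparse_count_to_false n k : sparse_count n k false false = 'C(n.+1 - k, k)
  /\ sparse_count n k true false = 'C(n - k, k).
Proof.
elim: n k => [|n IHn] k; first by split; case: k => [|[|k]].
split; last by rewrite sparse_countS add0n (IHn k).1.
rewrite sparse_countS (IHn k).1; case: k => [|k]; first by rewrite !subn0 !bin0.
rewrite (IHn k).2; have [le|lt] := leqP k n.
  by rewrite subSS subSn // subSS binS addnC.
by rewrite !bin_small //; lia.
Qed.

(** A word after the letter true starts with false, so the words of length n.+1
    between true and true are the words of length n between false and true; this
    closes the recursion on the first letter. *)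
Lemma sparse_count_to_true n k : sparse_count n k false true = 'C(n - k, k)
  /\ sparse_count n.+1 k true true = 'C(n - k, k).
Proof.
have tt m j : sparse_count m.+1 j true true = sparse_count m j false true.
  by rewrite sparse_countS.
rewrite tt; suff -> : sparse_count n k false true = 'C(n - k, k) by [].
elim/ltn_ind: n k => -[_ [|k]//|n IHn k]; rewrite sparse_countS IHn //.
case: k => [|k]; first by rewrite !subn0 !bin0.
case: n IHn => [|n] IHn; first by rewrite /sparse_count /=; case: k => [|k].
rewrite tt IHn //; have [le|lt] := leqP k n.
  by rewrite subSS subSn // subSS binS addnC.
by rewrite !bin_small //; lia.
Qed.

Definition indicator n (S : {set 'I_n}) : n.-tuple bool :=
  [tuple i \in S | i < n].

Lemma indicator_bij n : bijective (@indicator n).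
Proof.
exists (fun t => [set i | tnth t i]) => [S|t].
  by apply/setP => i; rewrite inE tnth_mktuple.
by apply: eq_from_tnth => i; rewrite tnth_mktuple inE.
Qed.

Lemma count_indicator n (S : {set 'I_n}) : count_mem true (indicator S) = #|S|.
Proof.
rewrite /= count_map cardE [in RHS]/enum_mem size_filter -enumT /=.
by apply: eq_count => i /=; rewrite eqb_id.
Qed.

(** Two cyclically consecutive positions are a vertex i and its successor
    [ordS i], the two ends of an edge. *)
Lemma independent_cycle n (S : {set 'I_n.+1}) :
  independent (cycle_adj n.+1) S = cycle sparse (indicator S).
Proof.
have nthE (i : 'I_n.+1) : nth false (indicator S) i = (i \in S).
  by rewrite -tnth_nth tnth_mktuple.
have cycleE : cycle sparse (indicator S) =
    [forall i : 'I_n.+1, ~~ ((i \in S) && (ordS i \in S))].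
  case sE : (tval (indicator S)) => [|a s];
    first by have := size_tuple (indicator S); rewrite sE.
  have size_s : size s = n by have := size_tuple (indicator S);
    rewrite sE => -[].
  have stepE (i : 'I_n.+1) : nth false (rcons s a) i = (ordS i \in S).
    rewrite nth_rcons size_s -nthE sE /=.
    have := ltn_ord i; rewrite ltnS leq_eqVlt => /predU1P[->|lt].
      by rewrite ltnn eqxx modnn.
    by rewrite lt modn_small.
  have headE (i : 'I_n.+1) : nth false (a :: rcons s a) i = (i \in S).
    by rewrite -rcons_cons nth_rcons /= size_s ltn_ord -nthE sE.
  apply/(pathP false)/forallP => [sp i|sp i].
    have := sp i; rewrite size_rcons size_s => /(_ (ltn_ord i)).
    by rewrite stepE headE.
  rewrite size_rcons size_s => lt.
  by have := sp (Ordinal lt); rewrite -stepE -headE.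
rewrite cycleE; apply/forallP/forallP => [ind i|ind i].
  apply/negP => /andP[iS i1S]; have := ind i;
    rewrite iS => /forallP/(_ (ordS i)).
  by rewrite i1S /cycle_adj eqxx.
apply/implyP => iS; apply/forallP => j; apply/implyP => jS.
rewrite negb_or; apply/andP; split; apply/negP => /eqP e.
  have := ind i; rewrite iS (_ : ordS i = j) ?jS //; exact: val_inj.
have := ind j; rewrite jS (_ : ordS j = i) ?iS //; exact: val_inj.
Qed.

(** Cut the cyclic word at its first letter: the rest is a word between two
    letters equal to it. *)
Lemma card_independent_cycle n k : (0 < n)%N ->
  #|[set S : {set 'I_n.+1} | independent (cycle_adj n.+1) S & #|S| == k]| =
    ('C(n.+1 - k, k) + if k is k'.+1 then 'C(n - k, k') else 0)%N.
Proof.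
case: n => // n _.
pose p (s : bitseq) := cycle sparse s && (count_mem true s == k).
transitivity #|[set t : n.+2.-tuple bool | p t]|.
  rewrite -(card_imset _ (bij_inj (indicator_bij n.+2))).
  apply: eq_card => t; have [g gK Kg] := indicator_bij n.+2.
  rewrite inE -(Kg t) (mem_imset _ _ (can_inj gK)) inE /p count_indicator.
  by rewrite independent_cycle.
rewrite card_tuple_bitseqs [bitseqs _]/= -/(bitseqs n.+1) count_cat !count_map
  addnC.
congr addn.
  rewrite -(sparse_count_to_false n.+1 k).1; apply: eq_count => s /=.
  by rewrite /p /= andbC.
case: k @p => [|k] p.
  by rewrite (eq_count (a2 := pred0)) ?count_pred0 // => s;
    rewrite /= /p /= andbF.
rewrite subSS -(sparse_count_to_true n k).2; apply: eq_count => s.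
by rewrite /= /p /= andbC.
Qed.

End SparseBitSequences.

(** * Betti numbers and projective dimension *)

Section IndependenceComplex.
Variables (K : fieldType) (n : nat) (adj : rel 'I_n).
Hypothesis n_gt0 : (0 < n)%N.

Lemma betti_indep_ideal i : betti (indep_ideal K adj) i =
  (\sum_(S : {set 'I_n} | independent adj S) 'C(#|S|, i))%N.
Proof.
rewrite (@betti_minimal _ _ (indep_ideal K adj) (indep_complex K adj)).
- exact: card_cells.
- by move=> f; apply: indep_ideal_const0.
- exact: indep_complex_minimal_resolution.
Qed.

Lemma has_proj_dim_indep_ideal d :
  (exists2 S : {set 'I_n}, independent adj S & #|S| = d) ->
  (forall S : {set 'I_n}, independent adj S -> (#|S| <= d)%N) ->
  has_proj_dim (quot_mod (indep_ideal K adj)) d.+1.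
Proof.
move=> [S0 ind0 card0] max_d.
have [_ resF minF] := indep_complex_minimal_resolution K adj.
have rankE := @card_cells n adj.
split=> [|e pd_e].
  apply: (proj_dim_le_rank resF) => i lt_di.
  rewrite /= rankE big1 // => S indS; apply: bin_small.
  exact: leq_ltn_trans (max_d S indS) lt_di.
apply: (proj_dim_ge_rank resF minF _ pd_e) => [f|].
  exact: indep_ideal_const0.
by rewrite /= rankE (bigD1 S0) //= card0 binn.
Qed.

End IndependenceComplex.

Section CycleGraph.
Variable n : nat.
Hypothesis n_gt1 : (2 <= n)%N.

Definition cycle_sets k :=
  [set S : {set 'I_n} | independent (cycle_adj n) S & #|S| == k].

Lemma card_cycle_sets k :
  #|cycle_sets k| =
    ('C(n - k, k) + if k is k'.+1 then 'C(n - k.+1, k') else 0)%N.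
Proof.
rewrite /cycle_sets; case: n n_gt1 => // N N_gt0.
by rewrite card_independent_cycle //; case: k => // k; rewrite subSS.
Qed.

Lemma cycle_sets_small k : (n./2 < k)%N -> #|cycle_sets k| = 0%N.
Proof.
move=> lt; have := odd_double_half n; rewrite card_cycle_sets.
case: k lt => // k lt nE; rewrite !bin_small //; lia.
Qed.

Lemma cycle_sets_half_gt0 : (0 < #|cycle_sets n./2|)%N.
Proof.
have := odd_double_half n; rewrite card_cycle_sets addn_gt0 bin_gt0 => nE.
by apply/orP; left; lia.
Qed.

(** The absorption identity k C(n-k, k) = (n-k) C(n-k-1, k-1) turns the sum of
    two binomials into a single one. *)
Lemma mul_card_cycle_sets k : (k <= n./2)%N ->
  ((n - k) * #|cycle_sets k| = n * 'C(n - k, k))%N.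
Proof.
move=> le; have := odd_double_half n; rewrite card_cycle_sets => nE.
case: k le => [|k] le; first by rewrite !subn0 addn0.
have -> : (n - k.+2 = (n - k.+1).-1)%N by lia.
by rewrite mulnDr mul_bin_diag -mulnDl subnK //; lia.
Qed.

Lemma sum_independent_cycle (f : nat -> nat) :
  (\sum_(S : {set 'I_n} | independent (cycle_adj n) S) f #|S| =
   \sum_(0 <= k < n./2.+1) #|cycle_sets k| * f k)%N.
Proof.
rewrite (partition_big (fun S : {set 'I_n} => inord #|S| : 'I_(n./2.+1)) predT)
  //= big_mkord.
apply: eq_bigr => k _.
have card_le (S : {set 'I_n}) : independent (cycle_adj n) S -> (#|S| <= n./2)%N.
  move=> indS; rewrite leqNgt; apply/negP => /cycle_sets_small/eqP.
  by rewrite cards_eq0 => /eqP/setP/(_ S); rewrite !inE indS eqxx.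
rewrite -sum_nat_const; apply: eq_big => [S|S /andP[indS /eqP <-]].
  rewrite inE; have [/card_le le|//] := boolP (independent _ _).
  by rewrite -val_eqE /= inordK.
by rewrite inordK // ltnS card_le.
Qed.

End CycleGraph.

Theorem corollary3p5 (n : nat) (hn : (2 <= n)%N) (K : fieldType) :
  (forall i : nat,
     (betti (indep_ideal K (cycle_adj n)) i)%:R =
       \sum_(0 <= k < n./2.+1)
         n%:R / (n - k)%:R * 'C(n - k, k)%:R * 'C(k, i)%:R :> rat) /\
  has_proj_dim (quot_mod (indep_ideal K (cycle_adj n))) (n./2 + 1)%N.
Proof.
have n_gt0 : (0 < n)%N by apply: ltnW.
split=> [i|].
  rewrite betti_indep_ideal //
    (@sum_independent_cycle _ hn (fun k => 'C(k, i))).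
  rewrite natr_sum; apply: eq_big_nat => k /andP[_ le_k].
  rewrite natrM; congr (_ * _).
  have nk_gt0 : (0 < n - k)%N by have := odd_double_half n; lia.
  have nk_neq0 : (n - k)%:R != 0 :> rat by rewrite Num.Theory.pnatr_eq0 -lt0n.
  rewrite mulrAC; apply: (canRL (mulfK nk_neq0)).
  by rewrite -!natrM -(mul_card_cycle_sets hn) // mulnC.
rewrite addn1; apply: has_proj_dim_indep_ideal => //.
  have /card_gt0P[S] := cycle_sets_half_gt0 hn.
  by rewrite inE => /andP[indS /eqP cardS]; exists S.
move=> S indS; rewrite leqNgt; apply/negP => /(cycle_sets_small hn)/eqP.
by rewrite cards_eq0 => /eqP/setP/(_ S); rewrite !inE indS eqxx.
Qed.
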